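(* Let $\phi$ be the Lorentzian inner product on the three-dimensional Heisenberg Lie algebra $\mathfrak{h}_3$ represented in the basis $\{f_1,g_1,z\}$ by the matrix $\begin{bmatrix}1&0&0\\0&0&1\\0&1&0\end{bmatrix}$. Then $(\mathfrak{h}_3,\phi)$ is flat.
   Context: The Heisenberg Lie algebra $\mathfrak{h}_3$ is the real Lie algebra with basis $\{f_1,g_1,z\}$ whose only nonzero bracket of basis elements (up to antisymmetry) is $[f_1,g_1]=z$. The Levi-Civita connection of a Lie algebra with Lorentzian inner product $(\mathfrak{g},\langle\cdot,\cdot\rangle)$ is the bilinear map $(u,v)\mapsto\nabla_uv$ on $\mathfrak{g}$ determined by the Koszul formula $2\langle\nabla_uv,w\rangle=\langle[u,v],w\rangle+\langle[w,u],v\rangle+\langle[w,v],u\rangle$. The Riemann curvature tensor is $R_{uv}w=\nabla_{[u,v]}w-\nabla_u\nabla_vw+\nabla_v\nabla_uw$. The inner product is called flat if its Riemann curvature tensor is identically zero. *)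

(* Defs.v *)
From HB Require Import structures.
From mathcomp Require Import all_boot all_order all_algebra.
From mathcomp Require Import boolp classical_sets reals.
From mathcomp Require Import ring lra.

Set Implicit Arguments.
Unset Strict Implicit.
Unset Printing Implicit Defensive.

Import Order.TTheory GRing.Theory Num.Theory.
Local Open Scope ring_scope.

(* Finite-dimensional Lie algebras over R. *)
HB.mixin Record Vector_isLie (R : nzRingType) L of Vector R L := {
  lie : L -> L -> L;
  lie_linearl : forall v, linear (lie^~ v);
  lie_linearr : forall u, linear (lie u);
  liexx : forall u, lie u u = 0;
  lie_jacobi : forall u v w,
    lie u (lie v w) + lie v (lie w u) + lie w (lie u v) = 0
}.

#[short(type="lieVectType")]
HB.structure Definition LieVector (R : nzRingType) :=
  { L of Vector R L & Vector_isLie R L }.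

Section LorentzianLieAlgebra.
Variables (R : realType) (L : lieVectType R).
Implicit Types (phi : {symmetric L}) (u v w : L).

(* Signature (-, +, ..., +) in dimension n.+2 >= 2, stated as the existence of
   a pseudo-orthonormal basis; such a form is nondegenerate. *)
Definition lorentzian phi : Prop :=
  exists (n : nat) (e : n.+2.-tuple L), basis_of fullv e /\
    forall i j : 'I_n.+2, phi (tnth e i) (tnth e j) =
      if i == j then (if i == ord0 then -1 else 1) else 0.

Definition gram_mx n (e : n.-tuple L) phi : 'M[R]_n :=
  \matrix_(i, j) phi (tnth e i) (tnth e j).

Definition koszul phi u v w : R :=
  phi (lie u v) w + phi (lie w u) v + phi (lie w v) u.

(* By [levi_civitaP] and [levi_civita_unique], this is the only map satisfying
   the Koszul formula when phi is Lorentzian; in particular it is bilinear. *)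
Definition levi_civita phi u v : L :=
  xget 0 [set x : L | forall w, 2 * phi x w = koszul phi u v w]%classic.

Definition riemann phi u v w : L :=
  let nabla := levi_civita phi in
  nabla (lie u v) w - nabla u (nabla v w) + nabla v (nabla u w).

Definition flat phi : Prop := forall u v w, riemann phi u v w = 0.

Lemma lorentzian_nondegenerate phi x :
  lorentzian phi -> (forall w, phi x w = 0) -> x = 0.
Proof.
move=> [n [e [ebasis ephi]]] x0.
rewrite (coord_basis ebasis (memvf x)); apply: big1 => i _.
suff -> : coord e i x = 0 by rewrite scale0r.
have := x0 (tnth e i); rewrite {1}(coord_basis ebasis (memvf x)).
rewrite linear_sumlz (bigD1 i) //= big1 ?addr0 => [|j ji].
  rewrite linearZl_LR /= -?tnth_nth ephi eqxx /=.
  by case: ifP => _; rewrite ?mulr1 // mulrN1 => /eqP; rewrite oppr_eq0 => /eqP.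
by rewrite linearZl_LR /= -?tnth_nth ephi (negPf ji) mulr0.
Qed.

Lemma koszul_linear phi u v : scalar (koszul phi u v).
Proof.
move=> a x y; rewrite /koszul !lie_linearl !linearPl !linearPr /=.
by ring.
Qed.

Lemma levi_civitaP phi u v w : lorentzian phi ->
  2 * phi (levi_civita phi u v) w =
    phi (lie u v) w + phi (lie w u) v + phi (lie w v) u.
Proof.
move=> [n [e [ebasis ephi]]]; rewrite -/(koszul phi u v w) /levi_civita.
move: w; pose P := [set x : L | forall w, 2 * phi x w = koszul phi u v w]%classic.
suff: P (xget 0 P) by [].
apply: xgetPex.
pose f : L -> R := koszul phi u v.
pose fL := GRing.isLinear.Build R L R _ f (@koszul_linear phi u v).
pose F : {linear L -> R | *%R} := HB.pack f fL.
exists (\sum_i (phi (tnth e i) (tnth e i) * F (tnth e i) / 2) *: tnth e i) => w.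
rewrite -/(f w) -[f w]/(F w) {2}(coord_basis ebasis (memvf w)).
rewrite {1}(coord_basis ebasis (memvf w)).
rewrite linear_sumlz linear_sum mulr_sumr; apply: eq_bigr => i _ /=.
rewrite linearZl_LR /= linear_sumr (bigD1 i) //= big1 ?addr0 => [|j ji].
  rewrite !linearZ /= -!tnth_nth ephi eqxx.
  have -> a x : f (a *: x) = a * f x by exact: (linearZ_LR F).
  by case: ifP => _; field.
by rewrite linearZ /= -tnth_nth ephi eq_sym (negPf ji) mulr0.
Qed.

Lemma levi_civita_unique phi u v x : lorentzian phi ->
  (forall w, 2 * phi x w = koszul phi u v w) -> x = levi_civita phi u v.
Proof.
move=> lphi xP; apply/eqP; rewrite -subr_eq0; apply/eqP.
apply: (lorentzian_nondegenerate lphi) => w.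
have := levi_civitaP u v w lphi; rewrite -/(koszul phi u v w) -xP.
by rewrite linearBl /=; lra.
Qed.

End LorentzianLieAlgebra.

(* The three-dimensional Heisenberg Lie algebra, in coordinates with respect to
   the basis f1 = 'e_0, g1 = 'e_1, z = 'e_2. *)
Definition heisenberg (R : realType) : Type := 'rV[R]_3.
HB.instance Definition _ (R : realType) := Vector.on (heisenberg R).

Section Heisenberg.
Variable R : realType.

Let o0 : 'I_3 := inord 0.
Let o1 : 'I_3 := inord 1.
Let o2 : 'I_3 := inord 2.

Definition f1 : heisenberg R := 'e_(inord 0).
Definition g1 : heisenberg R := 'e_(inord 1).
Definition z : heisenberg R := 'e_(inord 2).

Definition heisenberg_basis : 3.-tuple (heisenberg R) := [tuple f1; g1; z].

(* The bilinear extension of [f1, g1] = z = - [g1, f1], the other brackets of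
   basis elements being zero. *)
Definition heisenberg_lie (u v : heisenberg R) : heisenberg R :=
  (u 0 o0 * v 0 o1 - u 0 o1 * v 0 o0) *: z.

Lemma heisenberg_lie_linearl v : linear (heisenberg_lie^~ v).
Proof.
move=> a x y; rewrite /heisenberg_lie scalerA -scalerDl !mxE.
by congr (_ *: _); ring.
Qed.

Lemma heisenberg_lie_linearr u : linear (heisenberg_lie u).
Proof.
move=> a x y; rewrite /heisenberg_lie scalerA -scalerDl !mxE.
by congr (_ *: _); ring.
Qed.

Lemma heisenberg_liexx u : heisenberg_lie u u = 0.
Proof. by rewrite /heisenberg_lie mulrC subrr scale0r. Qed.

Let z0 : z 0 o0 = 0. Proof. by rewrite mxE -!val_eqE /= !inordK. Qed.
Let z1 : z 0 o1 = 0. Proof. by rewrite mxE -!val_eqE /= !inordK. Qed.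

Lemma heisenberg_lie_jacobi u v w :
  heisenberg_lie u (heisenberg_lie v w) + heisenberg_lie v (heisenberg_lie w u)
    + heisenberg_lie w (heisenberg_lie u v) = 0.
Proof.
have lie_z c x : heisenberg_lie x (c *: z) = 0.
  rewrite /heisenberg_lie [X in _ * X - _]mxE [X in _ - _ * X]mxE z0 z1.
  by rewrite !mulr0 subrr scale0r.
by rewrite !lie_z !addr0.
Qed.

HB.instance Definition _ := Vector_isLie.Build R (heisenberg R)
  heisenberg_lie_linearl heisenberg_lie_linearr heisenberg_liexx
  heisenberg_lie_jacobi.

Lemma lie_f1_g1 : lie f1 g1 = z.
Proof.
rewrite /lie /= /heisenberg_lie /f1 /g1 !mxE -!val_eqE /= !inordK //=.
by rewrite mulr1 mulr0 subr0 scale1r.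
Qed.

Lemma lie_f1_z : lie f1 z = 0.
Proof. by rewrite /lie /= /heisenberg_lie z0 z1 !mulr0 subrr scale0r. Qed.

Lemma lie_g1_z : lie g1 z = 0.
Proof. by rewrite /lie /= /heisenberg_lie z0 z1 !mulr0 subrr scale0r. Qed.

Lemma heisenberg_basisP : basis_of fullv heisenberg_basis.
Proof.
rewrite basisEdim dimvf /dim /= andbT.
apply/subvP => u _.
have -> : u = u 0 o0 *: f1 + u 0 o1 *: g1 + u 0 o2 *: z.
  apply/rowP => j; rewrite !mxE -!val_eqE /= !inordK //.
  case: j => [[|[|[|//]]] lj] /=;
    rewrite ?(mulr0, mulr1, addr0, add0r); congr (u 0 _);
    by apply: val_inj; rewrite /= inordK.
by rewrite !memvD ?memvZ // memv_span // !inE eqxx ?orbT.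
Qed.

Definition heisenberg_gram : 'M[R]_3 :=
  \matrix_(i, j) nth 0 (nth [::] [:: [:: 1; 0; 0];
                                     [:: 0; 0; 1];
                                     [:: 0; 1; 0]] i) j.

(* The form whose matrix is [heisenberg_gram]; with the next lemmas it shows that
   a Lorentzian form having this matrix exists. *)
Definition heisenberg_form (u v : heisenberg R) : R :=
  u 0 o0 * v 0 o0 + u 0 o1 * v 0 o2 + u 0 o2 * v 0 o1.

Lemma heisenberg_form_bilinear : bilinear_for
  (GRing.Scale.Law.clone _ _ *%R _) (GRing.Scale.Law.clone _ _ (idfun \; *%R) _)
  heisenberg_form.
Proof.
by split=> [v|u] a x y; rewrite /heisenberg_form !mxE /=; ring.
Qed.

HB.instance Definition _ :=
  bilinear_isBilinear.Build R (heisenberg R) (heisenberg R) R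
    (GRing.Scale.Law.clone _ _ *%R _)
    (GRing.Scale.Law.clone _ _ (idfun \; *%R) _)
    heisenberg_form heisenberg_form_bilinear.

Lemma heisenberg_form_sym u v :
  heisenberg_form u v = (-1) ^+ false * idfun (heisenberg_form v u).
Proof. by rewrite expr0 mul1r /= /heisenberg_form; ring. Qed.

HB.instance Definition _ :=
  isHermitianSesquilinear.Build R (heisenberg R) false idfun
    heisenberg_form heisenberg_form_sym.

Lemma heisenberg_form_gram :
  gram_mx heisenberg_basis heisenberg_form = heisenberg_gram.
Proof.
apply/matrixP => i j; rewrite !mxE /= /heisenberg_form.
case: i => [[|[|[|//]]] li]; case: j => [[|[|[|//]]] lj];
  rewrite !(tnth_nth 0) /= !mxE -!val_eqE /= !inordK //=;
  by rewrite ?(mulr0, mulr1, addr0, add0r).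
Qed.

Lemma heisenberg_form_lorentzian : lorentzian heisenberg_form.
Proof.
pose e : 3.-tuple (heisenberg R) :=
  [tuple g1 - 2^-1 *: z; f1; g1 + 2^-1 *: z].
exists 1%N, e; split.
  rewrite basisEdim; apply/andP; split; last by rewrite dimvf.
  rewrite -(span_basis heisenberg_basisP).
  have eP i : (i < 3)%N -> e`_i \in <<e>>%VS.
    by move=> ?; apply/memv_span/mem_nth; rewrite size_tuple.
  apply/span_subvP => x; rewrite !inE => /or3P[] /eqP ->.
  - exact: (eP 1%N).
  - have -> : g1 = 2^-1 *: (e`_0 + e`_2).
      by apply/rowP => j; rewrite !mxE; field.
    by apply/memvZ/memvD; apply: eP.
  - have -> : z = e`_2 - e`_0.
      by apply/rowP => j; rewrite !mxE; field.
    by apply: memvB; apply: eP.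
move=> i j; rewrite /= /heisenberg_form.
case: i => [[|[|[|//]]] li]; case: j => [[|[|[|//]]] lj];
  rewrite !(tnth_nth 0) /= !mxE -!val_eqE /= !inordK //=; by field.
Qed.

End Heisenberg.

(* Main.v *)
Require Import Defs.
From mathcomp Require Import all_boot all_order all_algebra.
From mathcomp Require Import reals.
From mathcomp Require Import ring.
Import GRing.Theory.
Local Open Scope ring_scope.

(** Every covariant derivative is a multiple of one fixed endomorphism.  The
    bracket takes its values in the line spanned by the central vector [z],
    which is null here, and [phi z u] is the [g1]-coordinate of [u].  The Koszul
    formula then gives [nabla_u = phi z u * D], where [D] is the skew-symmetric
    endomorphism [g1 |-> f1 |-> - z |-> 0] ([levi_civita_null_rotation]).
    Hence all the operators [nabla_u] commute with one another.  Moreover the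
    covariant derivative along a bracket is zero, because a bracket is a
    multiple of [z] and [phi z z = 0].  Both contributions to the curvature
    vanish. *)

Definition null_rotation (R : realType) (v : heisenberg R) : heisenberg R :=
  v 0 (inord 1) *: f1 R - v 0 (inord 0) *: z R.

Lemma null_rotationZ (R : realType) (a : R) (v : heisenberg R) :
  null_rotation R (a *: v) = a *: null_rotation R v.
Proof. by rewrite /null_rotation scalerBr !scalerA !mxE. Qed.

Lemma lie_coord1 (R : realType) (u v : heisenberg R) :
  (lie u v : heisenberg R) 0 (inord 1) = 0.
Proof.
by rewrite /lie /= /heisenberg_lie !mxE -!val_eqE /= !inordK //= mulr0.
Qed.

Lemma heisenberg_basis_expansion (R : realType) (u : heisenberg R) :
  u = u 0 (inord 0) *: f1 R + u 0 (inord 1) *: g1 R + u 0 (inord 2) *: z R.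
Proof.
apply/rowP => j; rewrite !mxE -!val_eqE /= !inordK //.
case: j => [[|[|[|//]]] lj] /=;
  rewrite ?(mulr0, mulr1, addr0, add0r); congr (u 0 _);
  by apply: val_inj; rewrite /= inordK.
Qed.

Lemma form_of_gram (R : realType) (phi : {symmetric (heisenberg R)})
    (u v : heisenberg R) :
  gram_mx (heisenberg_basis R) phi = heisenberg_gram R ->
  phi u v = heisenberg_form u v.
Proof.
move=> /matrixP gramE.
have entry (i j : 'I_3) :
    phi (tnth (heisenberg_basis R) i) (tnth (heisenberg_basis R) j) =
    heisenberg_gram R i j by rewrite -gramE mxE.
have basisE : (tnth (heisenberg_basis R) (inord 0) = f1 R) *
              (tnth (heisenberg_basis R) (inord 1) = g1 R) *
              (tnth (heisenberg_basis R) (inord 2) = z R).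
  by rewrite !(tnth_nth 0) /= !inordK.
rewrite {1}[u]heisenberg_basis_expansion {1}[v]heisenberg_basis_expansion.
rewrite !(linearDl, linearDr) /= !(linearZl_LR, linearZr_LR) /=.
rewrite -!basisE !entry !mxE /= !inordK //= /heisenberg_form.
by ring.
Qed.

(** In coordinates the Koszul expression equals
    [2 * u_1 * (v_1 * w_0 - v_0 * w_1)]: the terms in [u_0] cancel. *)
Lemma levi_civita_null_rotation (R : realType)
    (phi : {symmetric (heisenberg R)}) (u v : heisenberg R) :
  lorentzian phi ->
  gram_mx (heisenberg_basis R) phi = heisenberg_gram R ->
  levi_civita phi u v = u 0 (inord 1) *: null_rotation R v.
Proof.
move=> phi_lorentzian phi_gram; apply/esym.
apply: (levi_civita_unique phi_lorentzian) => w.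
rewrite /koszul !(form_of_gram R phi _ _ phi_gram) /heisenberg_form.
rewrite !lie_coord1 /lie /= /heisenberg_lie /null_rotation.
rewrite !mxE -!val_eqE /= !inordK //=.
by ring.
Qed.

Theorem mainTheorem10 (R : realType) (phi : {symmetric (heisenberg R)})
    (phi_lorentzian : lorentzian phi)
    (phi_gram : gram_mx (heisenberg_basis R) phi = heisenberg_gram R) :
  flat phi.
Proof.
move=> u v w; rewrite /riemann.
rewrite !(fun x y => levi_civita_null_rotation R phi x y phi_lorentzian phi_gram).
rewrite lie_coord1 scale0r sub0r !null_rotationZ !scalerA.
by rewrite [v 0 _ * _]mulrC addNr.
Qed.
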